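(* Let $n\ge 2$ be an integer and let $I_n=(x(y^n-z^n),\,y(z^n-x^n),\,z(x^n-y^n))\subset \mathbb{C}[x,y,z]$. Then: (1) $I_n^{(2r)}\subseteq \mathfrak{m}^rI_n^r$ for all integers $r\ge 1$. (2) $I_n^{(2r-1)}\subseteq \mathfrak{m}^{r-1}I_n^r$ for all integers $r\ge 3$ if $n\ge 3$, and for all integers $r\ge 1$ if $n=2$. (3) $I_n^{(2r-2)}\subseteq \mathfrak{m}^{r}I_n^r$ for all integers $r\ge 5$.
   Context: Let $R=\mathbb{C}[x,y,z]$ and let $\mathfrak{m}=(x,y,z)$ be its maximal homogeneous ideal. For a homogeneous ideal $I\subseteq R$ and an integer $m\ge 1$, the $m$-th symbolic power of $I$ is $I^{(m)}:=\bigcap_{\mathfrak{p}\in \mathrm{Ass}(R/I)} \left(I^mR_{\mathfrak{p}}\cap R\right)$. $I^r$ denotes the ordinary power, and $\mathfrak{m}^0=R$. *)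

(* Defs.v *)
From HB Require Import structures.
From mathcomp Require Import all_boot all_order all_algebra fraction.
From mathcomp Require Import ring_quotient mpoly.
From mathcomp Require Import boolp classical_sets reals complex.

Set Implicit Arguments.
Unset Strict Implicit.
Unset Printing Implicit Defensive.

Import GRing.Theory.
Local Open Scope classical_set_scope.
Local Open Scope ring_scope.

Local Notation "x %:F" := (tofrac x) (format "x %:F") : ring_scope.

Definition lin_span (B : comNzRingType) (S X : set B) : set B :=
  [set b | exists (k : nat) (c g : 'I_k -> B),
    [/\ forall i, S (c i), forall i, X (g i) & b = \sum_(i < k) c i * g i]].

Definition ideal_gen (A : comNzRingType) (X : set A) : set A :=
  lin_span setT X.

Definition ideal_mul (A : comNzRingType) (I J : set A) : set A :=
  ideal_gen [set a * b | a in I & b in J].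

Definition ideal_exp (A : comNzRingType) (I : set A) (m : nat) : set A :=
  iter m (ideal_mul I) setT.

(* P is a prime ideal (idealr_closed includes 1 \notin P) and is the annihilator
   of the class of some f in A / I. *)
Definition associated_prime (A : comNzRingType) (I : set A) (P : {pred A}) :
    Prop :=
  [/\ idealr_closed P, prime_idealr_closed P
    & exists f : A, forall a : A, a \in P <-> I (a * f)].

(* The localization of a domain at P, as a subring of the fraction field. *)
Definition localization (A : idomainType) (P : {pred A}) : set {fraction A} :=
  [set u | exists a s : A, s \notin P /\ u = a%:F / s%:F].

(* J A_P \cap A *)
Definition loc_contraction (A : idomainType) (J : set A) (P : {pred A}) :
    set A :=
  [set f | lin_span (localization P) [set g%:F | g in J] f%:F].

Definition symbolic_power (A : idomainType) (I : set A) (m : nat) : set A :=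
  [set f | forall P : {pred A}, associated_prime I P ->
    loc_contraction (ideal_exp I m) P f].

Section ThreeVariables.
Variable K : fieldType.

Let x : {mpoly K[3]} := 'X_(@Ordinal 3 0 isT).
Let y : {mpoly K[3]} := 'X_(@Ordinal 3 1 isT).
Let z : {mpoly K[3]} := 'X_(@Ordinal 3 2 isT).

Definition max_ideal : set {mpoly K[3]} := ideal_gen [set x; y; z].

Definition fermat_ideal (n : nat) : set {mpoly K[3]} :=
  ideal_gen [set x * (y ^+ n - z ^+ n);
                 y * (z ^+ n - x ^+ n);
                 z * (x ^+ n - y ^+ n)].

End ThreeVariables.

Arguments max_ideal : clear implicits.
Arguments fermat_ideal : clear implicits.

(* Main.v *)
(* Put U = y^n - z^n, V = z^n - x^n, W = x^n - y^n, so that I_n = (xU, yV, zW).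

   An element of I_n^(m) vanishes to order m at the n^2 points (w^u : w^v : 1), with
   w a primitive n-th root of unity, and at the three coordinate points. Splitting
   along degrees and along residues of the exponents modulo n, one may assume that it
   is x^i y^j z^k h(x^n, y^n, z^n), where h is a form in a, b, c with multiplicity m at
   (1:1:1) and prescribed multiplicities at the coordinate points. By induction on the
   multiplicity at (1:1:1), such an h is a combination of products of the lines a, b,
   c, b - c, c - a, a - b with the same multiplicities: modulo products with one more
   line through (1:1:1), a product only depends on the exponents of b - c, c - a,
   a - b, and the relations U + V + W = 0 and aU + bV + cW = 0 reduce these to
   products with independent leading forms at (1:1:1). Hence I_n^(m) is generated by the
   x^i y^j z^k U^p V^q W^s with p + q + s = m and order at least m at each coordinate
   point. These inequalities bound i + j + k from below.

   Expanding m - r of the factors U, V, W leaves monomials with p + q + s = r. If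
   i + j + k >= r + n - 1, the relations U + V + W = 0 and
   x^n U + y^n V + z^n W = 0 rewrite these into monomials with p <= i, q <= j, s <= k,
   which are visibly multiples of (xU)^p (yV)^q (zW)^s. *)
Require Import Defs.
From HB Require Import structures.
From mathcomp Require Import all_boot all_order all_algebra fraction.
From mathcomp Require Import ring_quotient mpoly classical_sets reals complex.
From mathcomp Require Import cyclic separable cyclotomic zify ring.

Set Implicit Arguments.
Unset Strict Implicit.
Unset Printing Implicit Defensive.

Import Order.TTheory GRing.Theory Num.Theory.
Local Open Scope classical_set_scope.
Local Open Scope ring_scope.

(** * Ideals and the rewriting of Fermat monomials *)

Section Ideals.
Variable A : comNzRingType.
Implicit Types (I J X : set A).

Definition is_ideal I : Prop :=
  [/\ I 0, forall a b, I a -> I b -> I (a + b) & forall c a, I a -> I (c * a)].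

Lemma idealN I a : is_ideal I -> I a -> I (- a).
Proof. by case=> _ _ IM Ia; rewrite -mulN1r; exact: IM. Qed.

Lemma idealB I a b : is_ideal I -> I a -> I b -> I (a - b).
Proof. by move=> idI Ia Ib; have [_ ID _] := idI; apply: ID => //; exact: idealN. Qed.

Lemma ideal_sum I k (F : 'I_k -> A) :
  is_ideal I -> (forall i, I (F i)) -> I (\sum_(i < k) F i).
Proof. by case=> I0 ID _ IF; apply: big_ind. Qed.

Lemma ideal_setT : is_ideal [set: A].
Proof. by split. Qed.

Lemma ideal_gen_ideal X : is_ideal (ideal_gen X).
Proof.
split.
- by exists 0%N, (fun=> 0), (fun=> 0); split=> [//|[]//|]; rewrite big_ord0.
- move=> _ _ [k [c [g [_ gX ->]]]] [l [d [h [_ hX ->]]]].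
  exists (k + l)%N, (fun i => match split i with inl j => c j | inr j => d j end),
    (fun i => match split i with inl j => g j | inr j => h j end).
  split=> // [i|]; first by case: (split i).
  rewrite big_split_ord /=; congr (_ + _); apply: eq_bigr => i _.
    by rewrite -[lshift _ _]/(unsplit (inl i)) unsplitK.
  by rewrite -[rshift _ _]/(unsplit (inr i)) unsplitK.
- move=> a _ [k [c [g [_ gX ->]]]]; exists k, (fun i => a * c i), g; split=> //.
  by rewrite mulr_sumr; apply: eq_bigr => i _; rewrite mulrA.
Qed.

Lemma sub_ideal_gen X : X `<=` ideal_gen X.
Proof.
move=> a Xa; exists 1%N, (fun=> 1), (fun=> a); split=> //.
by rewrite big_ord1 mul1r.
Qed.

Lemma ideal_gen_min X I : is_ideal I -> X `<=` I -> ideal_gen X `<=` I.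
Proof.
move=> idI XI _ [k [c [g [_ gX ->]]]]; apply: ideal_sum => // i.
by case: (idI) => _ _; apply; apply: XI.
Qed.

Lemma ideal_mul_ideal I J : is_ideal (ideal_mul I J).
Proof. exact: ideal_gen_ideal. Qed.

Lemma mem_ideal_mul I J a b : I a -> J b -> ideal_mul I J (a * b).
Proof. by move=> Ia Jb; apply: sub_ideal_gen; exists a => //; exists b. Qed.

Lemma ideal_exp_ideal I m : is_ideal (ideal_exp I m).
Proof. by case: m => [|m]; [exact: ideal_setT | exact: ideal_mul_ideal]. Qed.

Lemma mem_ideal_exp_mul I k l a b :
  ideal_exp I k a -> ideal_exp I l b -> ideal_exp I (k + l) (a * b).
Proof.
move=> + Ib; elim: k a => [|k IHk] a Ia.
  by rewrite add0n; case: (ideal_exp_ideal I l) => _ _; apply.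
move: a Ia; rewrite addSn; apply: (ideal_gen_min
  (I := [set a | ideal_exp I (k + l).+1 (a * b)])) => [|_ [c Ic [d Id <-]] /=].
  have [E0 ED EM] := ideal_exp_ideal I (k + l).+1.
  split=> /= [|c d Ic Id|c d Id]; first by rewrite mul0r.
    by rewrite mulrDl; exact: ED.
  by rewrite -mulrA; exact: EM.
by rewrite -mulrA; apply: mem_ideal_mul => //; exact: IHk.
Qed.

Lemma mem_ideal_expX I k a : I a -> ideal_exp I k (a ^+ k).
Proof.
move=> Ia; elim: k => [//|k IHk].
by rewrite exprS; exact: mem_ideal_mul.
Qed.

Lemma ideal_exp_anti I k l : (k <= l)%N -> ideal_exp I l `<=` ideal_exp I k.
Proof.
elim: l k => [|l IHl] [|k] // kl.
apply: ideal_gen_min; first exact: ideal_exp_ideal.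
by move=> _ [a Ia [b Ib <-]]; apply: mem_ideal_mul => //; exact: IHl Ib.
Qed.

End Ideals.

(** * Rewriting monomials by the relations between U, V and W *)

Section FermatMonomials.
Variables (A : comNzRingType) (n : nat).
Implicit Types (x y z : A) (Q : set A).

Definition fermat_monomial x y z (i j k a b c : nat) : A :=
  x ^+ i * y ^+ j * z ^+ k * (y ^+ n - z ^+ n) ^+ a *
  (z ^+ n - x ^+ n) ^+ b * (x ^+ n - y ^+ n) ^+ c.

(* The order of the monomial at the points (1:0:0), (0:1:0) and (0:0:1) is at
   least m. *)
Definition vanishing_exponents (m i j k a b c : nat) : Prop :=
  [/\ (m <= j + k + n * a)%N, (m <= i + k + n * b)%N
    & (m <= i + j + n * c)%N].

(** This cyclic symmetry lets the case [i < a] stand for all three cases of the rewriting. *)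
Lemma fermat_monomial_rot x y z i j k a b c :
  fermat_monomial y z x j k i b c a = fermat_monomial x y z i j k a b c.
Proof. by rewrite /fermat_monomial; ring. Qed.

(** Expanding one factor, say U = y^n - z^n, trades a unit of [a] for n more in [j] or [k]. This
    keeps the order at (1:0:0) and lowers none at the other two points. *)
Lemma fermat_monomial_expand x y z Q m r i j k a b c :
    (r <= m)%N -> (a + b + c = m)%N ->
    vanishing_exponents r i j k a b c -> is_ideal Q ->
    (forall i' j' k' a' b' c', (a' + b' + c' = r)%N ->
      (i' + j' + k' = i + j + k + n * (m - r))%N ->
      vanishing_exponents r i' j' k' a' b' c' ->
      Q (fermat_monomial x y z i' j' k' a' b' c')) ->
  Q (fermat_monomial x y z i j k a b c).
Proof.
move=> rm + van idQ; rewrite -(subnK rm).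
elim: (m - r)%N => [|d IHd] in i j k a b c van * => abc Qr.
  by apply: Qr => //; lia.
case: van => van1 van2 van3.
have [a0|[b0|c0]] : (0 < a \/ 0 < b \/ 0 < c)%N by lia.
- have -> : fermat_monomial x y z i j k a b c =
      fermat_monomial x y z i (j + n) k a.-1 b c -
      fermat_monomial x y z i j (k + n) a.-1 b c.
    by rewrite /fermat_monomial -[in LHS](prednK a0) !exprD exprS; ring.
  by apply: idealB => //; apply: IHd => [|| * ]; try (split; nia); try lia;
     apply: Qr => //; lia.
- have -> : fermat_monomial x y z i j k a b c =
      fermat_monomial x y z i j (k + n) a b.-1 c -
      fermat_monomial x y z (i + n) j k a b.-1 c.
    by rewrite /fermat_monomial -[in LHS](prednK b0) !exprD exprS; ring.
  by apply: idealB => //; apply: IHd => [|| * ]; try (split; nia); try lia;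
     apply: Qr => //; lia.
- have -> : fermat_monomial x y z i j k a b c =
      fermat_monomial x y z (i + n) j k a b c.-1 -
      fermat_monomial x y z i (j + n) k a b c.-1.
    by rewrite /fermat_monomial -[in LHS](prednK c0) !exprD exprS; ring.
  by apply: idealB => //; apply: IHd => [|| * ]; try (split; nia); try lia;
     apply: Qr => //; lia.
Qed.

(* Without the summand [i <= e] the measure would not drop in the steps that only
   turn an equality [i = e] into [e < i]. *)
Let defect (i e : nat) : nat := 2 * (e - i) + (i <= e)%N.

(** If also j <= b, the degree bound gives k >= c + n and the order at (0:0:1) gives c > 0, so z^n W
    = - x^n U - y^n V applies and preserves all three orders; for k <= c the roles of y and z are
    exchanged. If j > b and k > c, then U = - V - W applies: the order at (1:0:0) falls by n but
    stays at least r, because j + k >= b + c + 2. *)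
Lemma fermat_monomial_rewrite_aux x y z Q r i j k a b c d :
    (2 <= n)%N -> is_ideal Q ->
    (defect i a + defect j b + defect k c <= d)%N ->
    (a + b + c = r)%N -> (r + n <= (i + j + k).+1)%N ->
    vanishing_exponents r i j k a b c -> (i < a)%N ->
    (forall i' j' k' a' b' c',
      (defect i' a' + defect j' b' + defect k' c' < d)%N ->
      (a' + b' + c' = r)%N -> (i' + j' + k' = i + j + k)%N ->
      vanishing_exponents r i' j' k' a' b' c' ->
      Q (fermat_monomial x y z i' j' k' a' b' c')) ->
  Q (fermat_monomial x y z i j k a b c).
Proof.
move=> n2 idQ dle abc ijk [v1 v2 v3] ia IH.
have a0 : (0 < a)%N by lia.
have na : (n * a = n * a.-1 + n)%N by rewrite -[in LHS](prednK a0) mulnSr.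
case: (leqP j b) => [jb|bj]; last case: (leqP k c) => [kc|ck].
- have c0 : (0 < c)%N by case: (posnP c) v3 => // -> ; lia.
  have nc : (n * c = n * c.-1 + n)%N by rewrite -[in LHS](prednK c0) mulnSr.
  have kn : (n <= k)%N by lia.
  have -> : fermat_monomial x y z i j k a b c =
      - fermat_monomial x y z (i + n) j (k - n) a.+1 b c.-1
      - fermat_monomial x y z i (j + n) (k - n) a b.+1 c.-1.
    rewrite /fermat_monomial -[in LHS](prednK c0) -[in LHS](subnK kn) !exprD !exprS.
    by ring.
  apply: idealB => //; first apply: idealN => //; apply: IH;
    rewrite /defect in dle *; try split; lia.
- have b0 : (0 < b)%N by case: (posnP b) v2 => // -> ; lia.
  have nb : (n * b = n * b.-1 + n)%N by rewrite -[in LHS](prednK b0) mulnSr.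
  have jn : (n <= j)%N by lia.
  have -> : fermat_monomial x y z i j k a b c =
      - fermat_monomial x y z (i + n) (j - n) k a.+1 b.-1 c
      - fermat_monomial x y z i (j - n) (k + n) a b.-1 c.+1.
    rewrite /fermat_monomial -[in LHS](prednK b0) -[in LHS](subnK jn) !exprD !exprS.
    by ring.
  apply: idealB => //; first apply: idealN => //; apply: IH;
    rewrite /defect in dle *; try split; lia.
- have -> : fermat_monomial x y z i j k a b c =
      - fermat_monomial x y z i j k a.-1 b.+1 c
      - fermat_monomial x y z i j k a.-1 b c.+1.
    by rewrite /fermat_monomial -[in LHS](prednK a0) !exprS; ring.
  apply: idealB => //; first apply: idealN => //; apply: IH;
    rewrite /defect in dle *; try split; try lia; nia.
Qed.

(** Descent on the total [defect]: the rewriting keeps the degree and the order conditions, so it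
    can be repeated until no exponent of x, y, z is below that of U, V, W. *)
Lemma fermat_monomial_rewrite x y z Q r i j k a b c :
    (2 <= n)%N -> is_ideal Q ->
    (a + b + c = r)%N -> (r + n <= (i + j + k).+1)%N ->
    vanishing_exponents r i j k a b c ->
    (forall i' j' k' a' b' c', (a' + b' + c' = r)%N ->
      (i' + j' + k' = i + j + k)%N -> (a' <= i')%N -> (b' <= j')%N ->
      (c' <= k')%N -> Q (fermat_monomial x y z i' j' k' a' b' c')) ->
  Q (fermat_monomial x y z i j k a b c).
Proof.
move=> n2 idQ.
have [d] := ubnP (defect i a + defect j b + defect k c).
elim: d => // d IHd in i j k a b c *; rewrite ltnS => dle abc ijk van Qbase.
have IH i' j' k' a' b' c' :
    (defect i' a' + defect j' b' + defect k' c' < d)%N ->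
    (a' + b' + c' = r)%N -> (i' + j' + k' = i + j + k)%N ->
    vanishing_exponents r i' j' k' a' b' c' ->
    Q (fermat_monomial x y z i' j' k' a' b' c').
  move=> d' abc' ijk' van'; apply: IHd => //; first by rewrite ijk'.
  by move=> *; apply: Qbase => //; lia.
have [v1 v2 v3] := van.
case: (ltnP i a) => [ia|ai].
  by apply: (@fermat_monomial_rewrite_aux _ _ _ _ r _ _ _ _ _ _ d).
case: (ltnP j b) => [jb|bj].
  rewrite -fermat_monomial_rot.
  apply: (@fermat_monomial_rewrite_aux _ _ _ _ r _ _ _ _ _ _ d) => //; try lia.
    by split; lia.
  move=> i' j' k' a' b' c' ? ? ? [? ? ?]; rewrite fermat_monomial_rot.
  by apply: IH; try lia; split; lia.
case: (ltnP k c) => [kc|ck].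
  rewrite -2!fermat_monomial_rot.
  apply: (@fermat_monomial_rewrite_aux _ _ _ _ r _ _ _ _ _ _ d) => //; try lia.
    by split; lia.
  move=> i' j' k' a' b' c' ? ? ? [? ? ?]; rewrite 2!fermat_monomial_rot.
  by apply: IH; try lia; split; lia.
exact: Qbase.
Qed.

Section Membership.
Variables (x y z : A) (M I : set A).
Hypotheses (Mx : M x) (My : M y) (Mz : M z).
Hypothesis Ix : I (x * (y ^+ n - z ^+ n)).
Hypothesis Iy : I (y * (z ^+ n - x ^+ n)).
Hypothesis Iz : I (z * (x ^+ n - y ^+ n)).

Lemma fermat_monomial_mem_base r s i j k a b c :
    (a + b + c = r)%N -> (a <= i)%N -> (b <= j)%N -> (c <= k)%N ->
    (r + s <= i + j + k)%N ->
  ideal_mul (ideal_exp M s) (ideal_exp I r) (fermat_monomial x y z i j k a b c).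
Proof.
move=> <- ai bj ck rs.
have -> : fermat_monomial x y z i j k a b c =
    x ^+ (i - a) * y ^+ (j - b) * z ^+ (k - c) *
    ((x * (y ^+ n - z ^+ n)) ^+ a * (y * (z ^+ n - x ^+ n)) ^+ b *
     (z * (x ^+ n - y ^+ n)) ^+ c).
  rewrite /fermat_monomial -[in LHS](subnK ai) -[in LHS](subnK bj).
  by rewrite -[in LHS](subnK ck) !exprD !exprMn; ring.
apply: mem_ideal_mul.
  apply: (@ideal_exp_anti _ M s ((i - a) + (j - b) + (k - c))%N); first lia.
  by do 2?[apply: mem_ideal_exp_mul]; exact: mem_ideal_expX.
by do 2?[apply: mem_ideal_exp_mul]; exact: mem_ideal_expX.
Qed.

(** Expansion to r factors raises the degree by n(m - r). The first degree bound then feeds the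
    rewriting, and the second leaves s spare variables for the power of [M]. *)
Lemma fermat_monomial_mem m r s i j k a b c :
    (2 <= n)%N -> (r <= m)%N ->
    (a + b + c = m)%N -> vanishing_exponents r i j k a b c ->
    (r + n <= (i + j + k + n * (m - r)).+1)%N ->
    (r + s <= i + j + k + n * (m - r))%N ->
  ideal_mul (ideal_exp M s) (ideal_exp I r) (fermat_monomial x y z i j k a b c).
Proof.
move=> n2 rm abc van rn rs.
have idQ := ideal_mul_ideal (ideal_exp M s) (ideal_exp I r).
apply: (fermat_monomial_expand rm abc van idQ) => i' j' k' a' b' c' abc' ijk' van'.
apply: (fermat_monomial_rewrite n2 idQ abc' _ van'); first by rewrite ijk'.
move=> i1 j1 k1 a1 b1 c1 abc1 ijk1 ai bj ck.
by apply: fermat_monomial_mem_base => //; rewrite ijk1 ijk'.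
Qed.

End Membership.

End FermatMonomials.

(** * Symbolic powers and orders of vanishing *)

Section VanishingOrder.
Variable D : idomainType.
Implicit Types (p q : {poly D}) (u v : D).

Definition vanishing (m : nat) p : Prop := forall l, (l < m)%N -> p`_l = 0.

Lemma vanishing_is_ideal m : is_ideal (vanishing m).
Proof.
split=> [l _|p q pm qm l lm|c p pm l lm]; first by rewrite coef0.
  by rewrite coefD pm ?qm ?addr0.
rewrite coefM big1 // => i _; rewrite pm ?mulr0 //; lia.
Qed.

Lemma vanishingM m k p q :
  vanishing m p -> vanishing k q -> vanishing (m + k) (p * q).
Proof.
move=> pm qk l lmk; rewrite coefM big1 // => i _.
have [im|mi] := ltnP i m; first by rewrite pm ?mul0r.
by rewrite qk ?mulr0 //; have := ltn_ord i; lia.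
Qed.

(** The coefficients of [q] vanish one after the other, since the constant term of [p] is not a zero
    divisor. *)
Lemma vanishing_cancel m p q :
  p`_0 != 0 -> vanishing m (p * q) -> vanishing m q.
Proof.
move=> p0 pqm l; elim/ltn_ind: l => l IHl lm.
have /eqP := pqm l lm; rewrite coefM big_ord_recl subn0 big1 ?addr0.
  by rewrite mulf_eq0 (negPf p0) => /eqP.
by move=> i _; rewrite IHl ?mulr0 //= /bump; have := ltn_ord i; lia.
Qed.

(** [u] may be 0, as happens on lines of special slope: [k] is only a lower bound for the order. *)
Definition leading_at (k : nat) p u : Prop := vanishing k p /\ p`_k = u.

Lemma leading_atM k l p q u v :
  leading_at k p u -> leading_at l q v -> leading_at (k + l) (p * q) (u * v).
Proof.
move=> [pk pu] [ql qv]; split; first exact: vanishingM.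
have lt_k : (k < (k + l).+1)%N by lia.
rewrite coefM (bigD1 (Ordinal lt_k)) //= addKn pu qv big1 ?addr0 // => i.
rewrite -val_eqE /= => ik; have [i_lt|] := ltnP i k; first by rewrite pk ?mul0r.
by move=> ki; rewrite ql ?mulr0 //; have := ltn_ord i; lia.
Qed.

Lemma leading_atX k p u e :
  leading_at k p u -> leading_at (k * e) (p ^+ e) (u ^+ e).
Proof.
move=> pu; elim: e => [|e IHe].
  by rewrite muln0; split=> //; rewrite coef1.
by rewrite mulnS !exprS; exact: leading_atM.
Qed.

Lemma coef01_expX u e :
  (((1 + u *: 'X) ^+ e)`_0 = 1) * (((1 + u *: 'X) ^+ e)`_1 = u *+ e).
Proof.
elim: e => [|e [IH0 IH1]]; first by rewrite !coef1.
rewrite !exprS !coefM !big_ord_recl !big_ord0 /= !coefD !coef1 !coefZ !coefX /=.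
by rewrite /bump /= IH0 IH1 mulrS; split; ring.
Qed.

End VanishingOrder.

(** * From symbolic powers to orders of vanishing *)

Section SymbolicPower.
Variable A : idomainType.
Implicit Types (I J : set A) (P : {pred A}).

(** The product of the finitely many denominators stays outside [P], which is prime. *)
Lemma loc_contraction_denominator J P f :
    is_ideal J -> idealr_closed P -> prime_idealr_closed P ->
    loc_contraction J P f -> exists2 s, s \notin P & J (s * f).
Proof.
move=> idJ [P0 P1 _] primeP [k [c [g [cP gJ eq_f]]]].
suff [s sP [h Jh eq_h]] : exists2 s, s \notin P &
    exists2 h, J h & tofrac s * (\sum_(i < k) c i * g i) = tofrac h.
  exists s => //; suff -> : s * f = h by [].
  by apply/eqP; rewrite -tofrac_eq tofracM eq_f eq_h.
elim: k c g cP gJ {eq_f} => [|k IHk] c g cP gJ.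
  exists 1 => //; exists 0; first by case: idJ.
  by rewrite big_ord0 mulr0 tofrac0.
have [s sP [h Jh eq_h]] :=
  IHk (fun i => c (widen_ord (leqnSn k) i)) (fun i => g (widen_ord (leqnSn k) i))
    (fun i => cP _) (fun i => gJ _).
have [a [t [tP eq_c]]] := cP ord_max; have [b Jb eq_g] := gJ ord_max.
have t0 : tofrac t != 0.
  by rewrite tofrac_eq0; apply: contraNneq tP => ->.
exists (s * t); first by apply/negP => /primeP; rewrite (negPf sP) (negPf tP).
have [_ JD JM] := idJ; exists (t * h + (s * a) * b); first by apply: JD; apply: JM.
rewrite big_ord_recr /= mulrDr tofracD !tofracM -eq_h eq_c -eq_g; congr (_ + _).
  by rewrite mulrCA mulrA.
by rewrite mulrA -[X in X * _]mulrA [_ * (_ / _)]mulrC divfK.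
Qed.

(** [P] is associated because it is the annihilator of [w] modulo [I]. Elements of [I] map to order
    1, those of its m-th power to order m, and a multiplier outside [P] has nonzero constant term,
    hence cancels. *)
Lemma symbolic_power_vanishing (D : idomainType) (psi : {rmorphism A -> {poly D}})
    (P : {pred A}) I m f :
    (forall g, g \in P = ((psi g)`_0 == 0)) -> I `<=` [set g | g \in P] ->
    (exists2 w, w \notin P & forall g, g \in P -> I (g * w)) -> 
    symbolic_power I m f -> vanishing m (psi f).
Proof.
move=> PE IP [w wP PI] /(_ P) If.
have idP : idealr_closed P.
  split=> [||a u v]; rewrite !PE ?rmorph0 ?coef0 ?eqxx //.
    by rewrite rmorph1 coef1 oner_eq0.
  move=> /eqP u0 /eqP v0; rewrite rmorphD rmorphM coefD coef0M.
  by rewrite u0 v0 mulr0 addr0.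
have primeP : prime_idealr_closed P.
  by move=> u v; rewrite !PE rmorphM coef0M mulf_eq0.
have assocP : associated_prime I P.
  split=> //; exists w => a; split=> [|/IP /=]; first exact: PI.
  by move/primeP => /orP [//|]; rewrite (negPf wP).
have [s sP] := loc_contraction_denominator (ideal_exp_ideal I m) idP primeP (If assocP).
suff expI g : ideal_exp I m g -> vanishing m (psi g).
  by move/expI; rewrite rmorphM => /vanishing_cancel; apply; rewrite -PE.
elim: m {If} g => [|m IHm] g; first by [].
have [V0 VD VM] := vanishing_is_ideal D m.+1.
apply: (ideal_gen_min (I := [set g | vanishing m.+1 (psi g)])).
  by split=> /= [|a b Ia Ib|c a Ia]; rewrite ?rmorph0 ?rmorphD ?rmorphM; 
    [exact: V0|exact: VD|exact: VM].
move=> _ [a Ia [b Ib <-]] /=; rewrite rmorphM -addn1 addnC.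
apply: vanishingM; last exact: IHm.
by move=> [|//] _; apply/eqP; rewrite -PE; exact: IP.
Qed.

End SymbolicPower.

(** * Forms with multiple points at a quadrangle *)

Section LinearSpan.
Variables (K : fieldType) (V : lmodType K).

(** Inductive, so that linear properties are proved by induction on a combination. *)
Inductive kspan (X : set V) : V -> Prop :=
| kspan0 : kspan X 0
| kspan_cons (k : K) (u v : V) : X u -> kspan X v -> kspan X (k *: u + v).

Lemma kspan_gen X u : X u -> kspan X u.
Proof. by move=> Xu; rewrite -[u]addr0 -[u]scale1r; exact/kspan_cons/kspan0. Qed.

Lemma kspanD X u v : kspan X u -> kspan X v -> kspan X (u + v).
Proof.
move=> + Xv; elim=> [|k w w' Xw _ IH]; first by rewrite add0r.
by rewrite -addrA; exact: kspan_cons.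
Qed.

Lemma kspanZ X k u : kspan X u -> kspan X (k *: u).
Proof.
elim=> [|l w w' Xw _ IH]; first by rewrite scaler0; exact: kspan0.
by rewrite scalerDr scalerA; exact: kspan_cons.
Qed.

Lemma kspanN X u : kspan X u -> kspan X (- u).
Proof. by rewrite -scaleN1r; exact: kspanZ. Qed.

Lemma kspan_sum X (I : Type) (r : seq I) (P : pred I) (F : I -> V) :
  (forall i, P i -> kspan X (F i)) -> kspan X (\sum_(i <- r | P i) F i).
Proof. by move=> XF; apply: big_ind => //; [exact: kspan0 | exact: kspanD]. Qed.

End LinearSpan.

(** Starting at 2 keeps away from t = 1, where the leading form of a - b vanishes. *)
Lemma poly_eq0_nat (K : numFieldType) (p : {poly K}) :
  (forall l : nat, p.[l.+2%:R] = 0) -> p = 0.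
Proof.
move=> p_roots; apply/eqP; apply: contraT => p0.
have := max_poly_roots (rs := [seq l.+2%:R | l <- iota 0 (size p)]) p0.
rewrite size_map size_iota ltnn => -> //.
  by apply/allP => _ /mapP[l _ ->]; rewrite /root p_roots.
rewrite map_inj_uniq ?iota_uniq // => l l' /eqP.
by rewrite eqr_nat => /eqP[].
Qed.

(* In the coordinates [a], [b], [c] of the projective plane, the spans below are
   the forms of degree [e] with multiplicity [m] at (1:1:1) and [m1], [m2], [m3]
   at the coordinate points. *)
Section FourPoints.
Variables (K : numFieldType) (A : comAlgType K) (a b c : A) (e m1 m2 m3 : nat).

Definition line_product (p q s i j k : nat) : A :=
  a ^+ p * b ^+ q * c ^+ s * (b - c) ^+ i * (c - a) ^+ j * (a - b) ^+ k.

(** The lines through (1:0:0) are b, c and b - c, and cyclically. With l = p + q + s, the last three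
    conditions are upper bounds: p <= l + i - m1, q <= l + j - m2, s <= l + k - m3. *)
Definition admissible (m p q s i j k : nat) : Prop :=
  [/\ (i + j + k = m)%N, (p + q + s + m = e)%N, (m1 <= q + s + i)%N,
      (m2 <= p + s + j)%N & (m3 <= p + q + k)%N].

Definition admissible_span (m : nat) : A -> Prop :=
  kspan [set u | exists p q s i j k,
    admissible m p q s i j k /\ u = line_product p q s i j k].

Lemma line_product_span m p q s i j k :
  admissible m p q s i j k -> admissible_span m (line_product p q s i j k).
Proof. by move=> adm; apply: kspan_gen; exists p, q, s, i, j, k. Qed.

(** Replacing a factor a by b changes the product by a multiple of a - b, one more line through
    (1:1:1). Exchanges that approach the target exponents stay within the bounds. *)
Lemma line_product_slide m p q s p' q' s' i j k :
  admissible m p q s i j k -> admissible m p' q' s' i j k ->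
  admissible_span m.+1 (line_product p q s i j k - line_product p' q' s' i j k).
Proof.
have [d] := ubnP (((p - p') + (p' - p)) + ((q - q') + (q' - q)) +
  ((s - s') + (s' - s)))%N.
elim: d => // d IHd in p q s *; rewrite ltnS => dle adm adm'.
have [[ijk sum m1i m2j m3k] [_ sum' m1i' m2j' m3k']] := (adm, adm').
have step p1 q1 s1 : admissible m p1 q1 s1 i j k ->
    (((p1 - p') + (p' - p1)) + ((q1 - q') + (q' - q1)) +
      ((s1 - s') + (s' - s1)) < d)%N ->
    admissible_span m.+1 (line_product p q s i j k - line_product p1 q1 s1 i j k) ->
    admissible_span m.+1 (line_product p q s i j k - line_product p' q' s' i j k).
  move=> adm1 dlt /kspanD/(_ (IHd _ _ _ dlt adm1 adm')).
  by rewrite addrA subrK.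
(* Both triples have sum e - m, so if they differ, one exponent must go down and another one up. *)
have [/andP[pp qq]|[/andP[pp qq]|[/andP[pp qq]|[/andP[pp qq]|[/andP[pp qq]|
      [/andP[pp qq]|/and3P[/eqP-> /eqP-> /eqP->]]]]]]] :
    ((p' < p) && (q < q') \/ (p < p') && (q' < q) \/
    ((p' < p) && (s < s') \/ (p < p') && (s' < s) \/
    ((q' < q) && (s < s') \/ (q < q') && (s' < s) \/
    [&& p == p', q == q' & s == s'])))%N by lia.
- apply: (step p.-1 q.+1 s); [by split; lia | by lia |].
  rewrite [X in _ (X)](_ : _ = line_product p.-1 q s i j k.+1).
    by apply: line_product_span; split; lia.
  by rewrite /line_product -[in X in X - _](ltn_predK pp) !exprS; ring.
- apply: (step p.+1 q.-1 s); [by split; lia | by lia |].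
  rewrite [X in _ (X)](_ : _ = - line_product p q.-1 s i j k.+1).
    by apply: kspanN; apply: line_product_span; split; lia.
  by rewrite /line_product -[in X in X - _](ltn_predK qq) !exprS; ring.
- apply: (step p.-1 q s.+1); [by split; lia | by lia |].
  rewrite [X in _ (X)](_ : _ = - line_product p.-1 q s i j.+1 k).
    by apply: kspanN; apply: line_product_span; split; lia.
  by rewrite /line_product -[in X in X - _](ltn_predK pp) !exprS; ring.
- apply: (step p.+1 q s.-1); [by split; lia | by lia |].
  rewrite [X in _ (X)](_ : _ = line_product p q s.-1 i j.+1 k).
    by apply: line_product_span; split; lia.
  by rewrite /line_product -[in X in X - _](ltn_predK qq) !exprS; ring.
- apply: (step p q.-1 s.+1); [by split; lia | by lia |].
  rewrite [X in _ (X)](_ : _ = line_product p q.-1 s i.+1 j k).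
    by apply: line_product_span; split; lia.
  by rewrite /line_product -[in X in X - _](ltn_predK pp) !exprS; ring.
- apply: (step p q.+1 s.-1); [by split; lia | by lia |].
  rewrite [X in _ (X)](_ : _ = - line_product p q s.-1 i.+1 j k).
    by apply: kspanN; apply: line_product_span; split; lia.
  by rewrite /line_product -[in X in X - _](ltn_predK qq) !exprS; ring.
by rewrite subrr; exact: kspan0.
Qed.

(** Let l = p + q + s. If the bounds l + i - m1, l + j - m2, l + k - m3 add up to at least l, one
    triple below them serves all three products, with (b - c) + (c - a) + (a - b) = 0. Otherwise
    admissibility for k + 1 forces their sum to be l - 1, and a(b - c) + b(c - a) + c(a - b) = 0 is
    used. *)
Lemma line_product_relation m p q s i j k :
  admissible m p q s i j k.+1 -> (m1 <= p + q + s + i)%N ->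
  (m2 <= p + q + s + j)%N -> (m3 <= p + q + s + k)%N ->
  exists t1 t2 t3 : nat * nat * nat,
  [/\ admissible m t1.1.1 t1.1.2 t1.2 i.+1 j k,
      admissible m t2.1.1 t2.1.2 t2.2 i j.+1 k,
      admissible m t3.1.1 t3.1.2 t3.2 i j k.+1 &
      line_product t3.1.1 t3.1.2 t3.2 i j k.+1 =
        - line_product t1.1.1 t1.1.2 t1.2 i.+1 j k
        - line_product t2.1.1 t2.1.2 t2.2 i j.+1 k].
Proof.
move=> [ijk sum m1i m2j m3k]; set l := (p + q + s)%N => l1 l2 l3.
have [loose|tight] := leqP (m1 + m2 + m3) (2 * l + i + j + k).
  pose p' := minn l (l + i - m1); pose q' := minn (l - p') (l + j - m2).
  pose t := (p', q', l - p' - q')%N; exists t, t, t.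
  split; rewrite /t /=; try by split; lia.
  by rewrite /line_product !exprS; ring.
pose p' := (l + i - m1)%N; pose q' := (l + j - m2)%N; pose s' := (l + k - m3)%N.
exists (p'.+1, q', s'), (p', q'.+1, s'), (p', q', s'.+1).
split; rewrite /=; try by split; lia.
by rewrite /line_product !exprS; ring.
Qed.

(** By [line_product_slide] the exponents of a, b, c hardly matter; the greedy choice makes them
    functions of [m], [k] and [j]. *)
Let canonical_product (m k j : nat) : A :=
  let l := (e - m)%N in let i := (m - k - j)%N in
  let p := minn l (l + i - m1) in let q := minn (l - p) (l + j - m2) in
  line_product p q (l - p - q) i j k.

Let canonical_index (m k j : nat) : bool :=
  [&& j + k <= m, m1 <= e - m + (m - k - j) & m2 <= e - m + j]%N.

(** A normal form modulo one more order at (1:1:1): every product carries the least power of a - b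
    that admissibility allows, m3 - (e - m) truncated at 0, so only [j] varies. *)
Let representable (m : nat) (u : A) : Prop := exists c : nat -> K,
  admissible_span m.+1
    (u - \sum_(j < m.+1 | canonical_index m (m3 - (e - m)) j)
           c j *: canonical_product m (m3 - (e - m)) j).

Lemma representable_add m u v :
  representable m u -> representable m v -> representable m (u + v).
Proof.
move=> [c1 uc1] [c2 vc2]; exists (fun j => c1 j + c2 j).
under eq_bigr do rewrite scalerDl.
by rewrite big_split opprD addrACA; exact: kspanD.
Qed.

Lemma representable_scale m t u : representable m u -> representable m (t *: u).
Proof.
move=> [c1 uc1]; exists (fun j => t * c1 j).
under eq_bigr do rewrite -scalerA.
by rewrite -scaler_sumr -scalerBr; exact: kspanZ.
Qed.

Lemma representable_congr m u v :
  admissible_span m.+1 (u - v) -> representable m v -> representable m u.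
Proof.
move=> uv [c1 vc1]; exists c1.
by rewrite -[u](subrK v) -addrA; exact: kspanD.
Qed.

Lemma line_product_representable_base m p q s i j k :
  (k <= m3 - (e - m))%N -> admissible m p q s i j k ->
  representable m (line_product p q s i j k).
Proof.
move=> kk0 adm; have [ijk sum m1i m2j m3k] := adm.
have jm : (j < m.+1)%N by lia.
have def_k : k = (m3 - (e - m))%N by lia.
have def_i : i = (m - k - j)%N by lia.
exists (fun l => (l == j)%:R); rewrite -def_k.
rewrite (bigD1 (Ordinal jm)) /=; last by rewrite /canonical_index; lia.
rewrite eqxx scale1r big1 ?addr0 => [|l /andP[_]]; last first.
  by rewrite -val_eqE /= => /negPf->; rewrite scale0r.
rewrite /canonical_product -def_i; apply: line_product_slide => //.
by split; lia.
Qed.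

(** Above the least exponent of a - b, a slide followed by [line_product_relation] trades one factor
    a - b for b - c or c - a. *)
Lemma line_product_representable m p q s i j k :
  admissible m p q s i j k -> representable m (line_product p q s i j k).
Proof.
elim: k => [|k IHk] in p q s i j *.
  exact: line_product_representable_base.
have [kk0|k0k] := leqP k.+1 (m3 - (e - m)).
  exact: line_product_representable_base.
move=> adm; have [ijk sum m1i m2j m3k] := adm.
have [||| [[p1 q1] s1] [[[p2 q2] s2] [[[p3 q3] s3] /= [adm1 adm2 adm3 rel]]]] :=
  line_product_relation adm; try lia.
apply: (representable_congr (line_product_slide adm adm3)).
rewrite rel -2!scaleN1r; apply: representable_add; apply: representable_scale;
  exact: IHk.
Qed.

Lemma admissible_span_representable m u :
  admissible_span m u -> representable m u.
Proof.
elim=> [|t v w [p [q [s [i [j [k [adm ->]]]]]]] _ IH].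
  exists (fun=> 0); rewrite big1 ?subr0; last by move=> l _; rewrite scale0r.
  exact: kspan0.
apply: representable_add => //; apply: representable_scale.
exact: line_product_representable.
Qed.

(** * Leading forms along lines through (1:1:1) *)

Section Test.
Variables (phi : K -> {rmorphism A -> {poly K}}) (nu : K).
Hypothesis nu0 : nu != 0.
Hypothesis phiZ : forall t k u, phi t (k *: u) = k *: phi t u.
Hypothesis phi_a : forall t, leading_at 0 (phi t a) 1.
Hypothesis phi_b : forall t, leading_at 0 (phi t b) 1.
Hypothesis phi_c : forall t, leading_at 0 (phi t c) 1.
Hypothesis phi_bc : forall t, leading_at 1 (phi t (b - c)) nu.
Hypothesis phi_ca : forall t, leading_at 1 (phi t (c - a)) (- (nu * t)).
Hypothesis phi_ab : forall t, leading_at 1 (phi t (a - b)) (nu * (t - 1)).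

Lemma phi_line_product t p q s i j k :
  leading_at (i + j + k) (phi t (line_product p q s i j k))
    (nu ^+ i * (- (nu * t)) ^+ j * (nu * (t - 1)) ^+ k).
Proof.
rewrite /line_product !rmorphM !rmorphXn /=.
have := leading_atM (leading_atM (leading_atM
  (leading_atM (leading_atM (leading_atX p (phi_a t)) (leading_atX q (phi_b t)))
    (leading_atX s (phi_c t)))
  (leading_atX i (phi_bc t))) (leading_atX j (phi_ca t))) (leading_atX k (phi_ab t)).
by rewrite !mul0n !mul1n !add0n !expr1n !mul1r.
Qed.

Lemma admissible_span_vanishing t m u :
  admissible_span m u -> vanishing m (phi t u).
Proof.
have [V0 VD VM] := vanishing_is_ideal K m.
elim=> [|k v w [p [q [s [i [j [l [[ijk _ _ _ _] ->]]]]]]] _ IH].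
  by rewrite rmorph0.
rewrite rmorphD phiZ; apply: VD => //; rewrite -mul_polyC; apply: VM.
by rewrite -ijk; case: (phi_line_product t p q s i j l).
Qed.

(** Along each line the coefficient of X^m in [u] is that of its canonical part [v], hence 0. The
    leading forms in [v] share the factor (nu (t - 1))^k0 and otherwise carry distinct powers t^j,
    so all coefficients of [v] vanish. *)
Lemma admissible_spanS m u :
  admissible_span m u -> (forall t, vanishing m.+1 (phi t u)) ->
  admissible_span m.+1 u.
Proof.
move=> /admissible_span_representable[k]; set k0 := (m3 - _)%N.
set v := \sum_(_ < _ | _) _.
move=> uv u0; suff v0 : v = 0 by move: uv; rewrite v0 subr0.
have phi_v t : \sum_(j < m.+1 | canonical_index m k0 j)
    k j * (nu ^+ (m - k0 - j) * (- (nu * t)) ^+ j * (nu * (t - 1)) ^+ k0) = 0.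
  have : (phi t v)`_m = 0.
    rewrite -[v](subKr u) rmorphB coefB u0 // (admissible_span_vanishing t uv) //.
    by rewrite subrr.
  rewrite rmorph_sum /= coef_sum => v0; rewrite -[RHS]v0; apply: eq_bigr => j.
  case/and3P=> jk _ _; rewrite phiZ coefZ; congr (_ * _).
  have mE : (m - k0 - j + j + k0 = m)%N by lia.
  set p := minn (e - m) (e - m + (m - k0 - j) - m1).
  set q := minn (e - m - p) (e - m + j - m2).
  by case: (phi_line_product t p q (e - m - p - q) (m - k0 - j) j k0); rewrite mE.
have coef0 j : (j < m.+1)%N -> canonical_index m k0 j -> k j = 0.
  move=> jm jv.
  (* The coefficient of X^m as a polynomial in t, with (nu (t - 1))^k0 divided out. *)
  pose P := \poly_(j < m.+1)
    (if canonical_index m k0 j then k j * nu ^+ (m - k0 - j) * (- nu) ^+ j else 0).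
  have P0 : P = 0.
    apply: poly_eq0_nat => l; have := phi_v l.+2%:R.
    have l1 : (nu * (l.+2%:R - 1)) ^+ k0 != 0 :> K.
      by rewrite expf_neq0 // mulf_neq0 // -natr1 addrK pnatr_eq0.
    under eq_bigr do rewrite !mulrA.
    rewrite -mulr_suml => /eqP; rewrite mulf_eq0 (negPf l1) orbF => /eqP v0.
    rewrite horner_poly -[RHS]v0 [RHS]big_mkcond; apply: eq_bigr => h _.
    by case: ifP => _; rewrite ?mul0r // -mulNr exprMn; ring.
  have := congr1 (fun p : {poly K} => p`_j) P0; rewrite coef0 coef_poly jm jv.
  by move/eqP; rewrite !mulf_eq0 !expf_eq0 oppr_eq0 (negPf nu0) !andbF !orbF => /eqP.
by apply: big1 => j jv; rewrite coef0 // scale0r.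
Qed.

End Test.

End FourPoints.

(** * The points of the Fermat configuration *)

Local Notation i0 := (@Ordinal 3 0 isT).
Local Notation i1 := (@Ordinal 3 1 isT).
Local Notation i2 := (@Ordinal 3 2 isT).
Local Notation mpC := (@mpolyC 3 _).

Section Substitution.
Variable K : numFieldType.
Local Notation R3 := {mpoly K[3]}.
Implicit Types (h : 'I_3 -> R3) (f g w : R3) (I : set R3).

(** Coefficients stay in the polynomial ring so that [h0] can be a generic point of the affine line
    over a projective point; evaluation at [h0] then has the homogeneous prime of that point as
    kernel. *)
Definition perturb h0 h1 g : {poly R3} :=
  mmap (polyC \o mpC) (fun i => (h0 i)%:P + (h1 i)%:P * 'X) g.

HB.instance Definition _ h0 h1 :=
  GRing.RMorphism.copy (perturb h0 h1)
    (mmap (polyC \o mpC) (fun i => (h0 i)%:P + (h1 i)%:P * 'X)).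

Lemma perturbZX h0 h1 c mm :
  perturb h0 h1 (c *: 'X_[mm]) =
  c%:MP%:P * mmap1 (fun i => (h0 i)%:P + (h1 i)%:P * 'X) mm.
Proof. by rewrite /perturb mmapZ mmapX. Qed.

Lemma perturbD h0 h1 f g :
  perturb h0 h1 (f + g) = perturb h0 h1 f + perturb h0 h1 g.
Proof. exact: mmapD. Qed.

Lemma perturb_coef0 h0 h1 g : (perturb h0 h1 g)`_0 = mmap mpC h0 g.
Proof.
elim/mpolyind: g => [|c m g _ _ IHg]; first by rewrite /perturb !mmap0 coef0.
rewrite perturbD coefD mmapD; congr (_ + _); last exact: IHg.
rewrite perturbZX mmapZ mmapX /mmap1 coef0M coefC; congr (_ * _).
rewrite -horner_coef0 horner_prod; apply: eq_bigr => i _.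
by rewrite horner_exp !hornerE.
Qed.

Lemma mmap_congr I h g :
  is_ideal I -> (forall i, I ('X_i - h i)) -> I (g - mmap mpC h g).
Proof.
move=> idI Ih; have [I0 ID IM] := idI.
have IMB a a' b b' : I (a - a') -> I (b - b') -> I (a * b - a' * b').
  move=> Ia Ib; have -> : a * b - a' * b' = b * (a - a') + a' * (b - b') by ring.
  by apply: ID; exact: IM.
elim/mpolyind: g => [|c m g _ _ IHg]; first by rewrite mmap0 subr0.
rewrite mmapD opprD addrACA mmapZ mmapX; apply: ID => //.
rewrite -mul_mpolyC -mulrBr; apply: IM; rewrite mpolyXE_id /mmap1.
apply: (big_ind2 (fun a b => I (a - b))) => [|a a' b b'|i _]; first by rewrite subrr.
  exact: IMB.
elim: (m i) => [|e IHe]; first by rewrite subrr.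
by rewrite !exprS; exact: IMB.
Qed.

(** The elements [v] with [v * w] in [I] form an ideal containing every ['X_i - h0 i], hence, by
    [mmap_congr], the whole kernel of evaluation at [h0]. *)
Lemma symbolic_power_perturb I h0 h1 w m f :
    is_ideal I -> (forall g, I g -> mmap mpC h0 g = 0) ->
    mmap mpC h0 w != 0 -> (forall i, I (('X_i - h0 i) * w)) ->
    symbolic_power I m f ->
  vanishing m (perturb h0 h1 f).
Proof.
move=> idI Ih0 w0 Iw If.
pose P : {pred R3} := [pred g | mmap mpC h0 g == 0].
apply: (@symbolic_power_vanishing _ _ (perturb h0 h1 : {rmorphism _ -> _}) P I) => //.
- by move=> g; rewrite perturb_coef0 inE.
- by move=> g Ig /=; rewrite inE Ih0.
exists w => [|g]; rewrite inE // => /eqP g0.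
rewrite -[g]subr0 -g0; apply: (@mmap_congr [set v | I (v * w)]) => //.
have [I0 ID IM] := idI; split=> /= [|u v Iu Iv|c u Iu].
- by rewrite mul0r.
- by rewrite mulrDl; exact: ID.
- by rewrite -mulrA; exact: IM.
Qed.

End Substitution.

(** * Order conditions at the points, and generators of the symbolic powers *)

Section FermatPoints.
Variables (K : numFieldType) (n : nat).
Hypothesis n_gt0 : (0 < n)%N.
Local Notation R3 := {mpoly K[3]}.
Implicit Types (f : R3) (m : nat).

Let x : R3 := 'X_i0.
Let y : R3 := 'X_i1.
Let z : R3 := 'X_i2.
Local Notation I := (fermat_ideal K n).

Lemma fermat_ideal_gens :
  [/\ I (x * (y ^+ n - z ^+ n)), I (y * (z ^+ n - x ^+ n)) &
      I (z * (x ^+ n - y ^+ n))].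
Proof. by split; apply: sub_ideal_gen; [left; left|left; right|right]. Qed.

Lemma fermat_ideal_ideal : is_ideal I.
Proof. exact: ideal_gen_ideal. Qed.

Lemma fermat_ideal_ker (h : 'I_3 -> R3) :
    h i0 * (h i1 ^+ n - h i2 ^+ n) = 0 -> h i1 * (h i2 ^+ n - h i0 ^+ n) = 0 ->
    h i2 * (h i0 ^+ n - h i1 ^+ n) = 0 ->
  forall g, I g -> mmap mpC h g = 0.
Proof.
move=> hx hy hz; apply: ideal_gen_min => [|_ [[|]|] ->] /=.
- split=> /= [|a b a0 b0|c a a0]; first exact: mmap0.
    by rewrite mmapD a0 b0 addr0.
  by rewrite rmorphM /= a0 mulr0.
all: by rewrite rmorphM rmorphB !rmorphXn /= !mmapX !mmap1U.
Qed.

Let msum3 (mm : 'X_{1..3}) : mdeg mm = (mm i0 + mm i1 + mm i2)%N.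
Proof.
rewrite mdegE !big_ord_recl big_ord0 addn0 addnA.
by congr (mm _ + mm _ + mm _)%N; apply: val_inj.
Qed.

Let mprod3 (D : comNzRingType) (h : 'I_3 -> D) mm :
  mmap1 h mm = h i0 ^+ mm i0 * h i1 ^+ mm i1 * h i2 ^+ mm i2.
Proof.
rewrite /mmap1 !big_ord_recl big_ord0 mulr1 mulrA.
by congr (h _ ^+ mm _ * h _ ^+ mm _ * h _ ^+ mm _); apply: val_inj.
Qed.

(** The substitution fixes X_k and multiplies every other variable by ['X]. A monomial is thus
    multiplied by ['X] to its degree in the other variables, and distinct monomials cannot
    cancel. *)
Lemma symbolic_power_coordinate_point (k : 'I_3) (w : R3) m f mm :
    (forall i, i != k -> I ('X_i * w)) ->
    mmap mpC (fun i => if i == k then 'X_i else 0) w != 0 ->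
    symbolic_power I m f -> mm \in msupp f -> (m <= mdeg mm - mm k)%N.
Proof.
move=> Iw w0 If mmf; rewrite leqNgt; apply/negP => lt_m.
pose h0 i : R3 := if i == k then 'X_i else 0.
pose h1 i : R3 := if i == k then 0 else 'X_i.
have Ih0 : forall g, I g -> mmap mpC h0 g = 0.
  by apply: fermat_ideal_ker; rewrite /h0; case: (k) => [[|[|[|]]]] //= k3;
    rewrite ?expr0n ?(gtn_eqF n_gt0) ?mul0r ?subrr ?mulr0.
have Iw' i : I (('X_i - h0 i) * w).
  rewrite /h0; case: eqP => [->|/eqP ik]; last by rewrite subr0; exact: Iw.
  by rewrite subrr mul0r; case: fermat_ideal_ideal.
have V := symbolic_power_perturb h1 fermat_ideal_ideal Ih0 w0 Iw' If.
have perturbX (m' : 'X_{1..3}) : mmap1 (fun i => (h0 i)%:P + (h1 i)%:P * 'X) m' =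
    ('X_[m'])%:P * 'X^(mdeg m' - m' k) :> {poly R3}.
  have -> : (mdeg m' - m' k)%N = (\sum_(i < 3 | i != k) m' i)%N.
    by rewrite mdegE (bigD1 k) //= addKn.
  rewrite mpolyXE_id rmorph_prod /mmap1 (bigD1 k) //= [in RHS](bigD1 k) //=.
  rewrite -prodrXr -mulrA -big_split /= /h0 /h1 eqxx polyC0 mul0r addr0 rmorphXn.
  congr (_ * _); apply: eq_bigr => i /negPf->.
  by rewrite polyC0 add0r exprMn rmorphXn.
have := V _ lt_m; rewrite {1}[f]mpolyE /perturb raddf_sum coef_sum => /= coef_f.
have := congr1 (mcoeff mm) coef_f; rewrite raddf_sum mcoeff0 /=.
rewrite (bigD1_seq mm) ?msupp_uniq //= big1 => [|m' m'mm].
  rewrite addr0 mmapZ mmapX perturbX /= mulrA -polyCM coefCM coefXn eqxx mulr1.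
  by rewrite mcoeffCM mcoeffX eqxx mulr1 => /eqP; rewrite mcoeff_eq0 mmf.
rewrite mmapZ mmapX perturbX /= mulrA -polyCM coefCM coefXn -mulrA mcoeffCM.
by case: eqP => _; rewrite ?mulr1 ?mulr0 ?mcoeff0 ?mcoeffX ?(negPf m'mm) mulr0.
Qed.

Let mpolyX_neq0 i : 'X_i != 0 :> R3.
Proof. by rewrite -msupp_eq0 msuppX. Qed.

(** At (1:0:0) the multiplier is V W: both y V W and z V W lie in I_n, while V W is nonzero there.
    The other two points are similar. *)
Lemma symbolic_power_exponents m f mm :
  symbolic_power I m f -> mm \in msupp f ->
  [/\ m <= mm i1 + mm i2, m <= mm i0 + mm i2 & m <= mm i0 + mm i1]%N.
Proof.
move=> If mmf; have [Ix Iy Iz] := fermat_ideal_gens.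
have [_ _ IM] := fermat_ideal_ideal.
have X0 i : 'X_i ^+ n != 0 :> R3 by rewrite expf_neq0 // mpolyX_neq0.
split.
- have := @symbolic_power_coordinate_point i0
    ((z ^+ n - x ^+ n) * (x ^+ n - y ^+ n)) m f mm.
  rewrite msum3 -addnA addKn; apply=> //.
    case=> [[|[|[|]]]] // i3 _; rewrite (bool_irrelevance i3 isT).
      by rewrite mulrA mulrC; exact: IM.
    by rewrite mulrCA; exact: IM.
  rewrite rmorphM !rmorphB !rmorphXn /= !mmapX !mmap1U /= expr0n gtn_eqF //=.
  by rewrite sub0r subr0 mulNr oppr_eq0 mulf_neq0.
- have := @symbolic_power_coordinate_point i1
    ((y ^+ n - z ^+ n) * (x ^+ n - y ^+ n)) m f mm.
  rewrite msum3 addnAC addnK; apply=> //.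
    case=> [[|[|[|]]]] // i3 _; rewrite (bool_irrelevance i3 isT).
      by rewrite mulrA mulrC; exact: IM.
    by rewrite mulrCA; exact: IM.
  rewrite rmorphM !rmorphB !rmorphXn /= !mmapX !mmap1U /= expr0n gtn_eqF //=.
  by rewrite sub0r subr0 mulrN oppr_eq0 mulf_neq0.
- have := @symbolic_power_coordinate_point i2
    ((y ^+ n - z ^+ n) * (z ^+ n - x ^+ n)) m f mm.
  rewrite msum3 addnK; apply=> //.
    case=> [[|[|[|]]]] // i3 _; rewrite (bool_irrelevance i3 isT).
      by rewrite mulrA mulrC; exact: IM.
    by rewrite mulrCA; exact: IM.
  rewrite rmorphM !rmorphB !rmorphXn /= !mmapX !mmap1U /= expr0n gtn_eqF //=.
  by rewrite sub0r subr0 mulNr oppr_eq0 mulf_neq0.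
Qed.

Variable w : K.
Hypothesis w_prim : n.-primitive_root w.

(* The monomial with exponents [mm], restricted to the line [(1 + t'X, 1 + 'X, 1)]
   through (1:1:1). *)
Definition monomial_on_line (t : K) (mm : 'X_{1..3}) : {poly K} :=
  (1 + t *: 'X) ^+ mm i0 * (1 + 1 *: 'X) ^+ mm i1.

(** The quotient (a^n - b^n) / (a - b). *)
Let cofactor (a b : R3) : R3 := \sum_(i < n) a ^+ (n.-1 - i) * b ^+ i.

Let w_neq0 : w != 0.
Proof.
apply/eqP => w0; have /eqP := prim_expr_order w_prim.
by rewrite w0 expr0n gtn_eqF //= eq_sym oner_eq0.
Qed.

Let cofactor_diag (a : R3) : cofactor a a = a ^+ n.-1 *+ n.
Proof.
rewrite /cofactor -[X in _ *+ X]card_ord -sumr_const; apply: eq_bigr => i _.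
by rewrite -exprD subnK //; have := ltn_ord i; lia.
Qed.

Let unity_scale u : (w ^+ u *: z) ^+ n = z ^+ n.
Proof.
by rewrite exprZn -exprM mulnC exprM (prim_expr_order w_prim) expr1n scale1r.
Qed.

(** At (w^u : w^v : 1), each monomial restricts to its value at the point times [monomial_on_line],
    with a power of z that records its degree; the coefficient of z^d isolates degree d. *)
Lemma symbolic_power_fermat_point u v t d l m f :
    symbolic_power I m f -> (l < m)%N ->
  \sum_(mm <- msupp f | mdeg mm == d)
    f@_mm * w ^+ (u * mm i0 + v * mm i1) * (monomial_on_line t mm)`_l = 0.
Proof.
move=> If lm; have [Ix Iy Iz] := fermat_ideal_gens.
have [I0 _ IM] := fermat_ideal_ideal.
pose h0 (i : 'I_3) : R3 := [:: w ^+ u *: z; w ^+ v *: z; z]`_i.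
pose h1 (i : 'I_3) : R3 := [:: t *: (w ^+ u *: z); 1 *: (w ^+ v *: z); 0]`_i.
(* Nonzero at the point, but its products with x - w^u z and y - w^v z are multiples of yV and
   xU. *)
pose cof := x * y * (cofactor x (w ^+ u *: z) * cofactor y (w ^+ v *: z)).
have z0 : z != 0 by exact: mpolyX_neq0.
have w0 e : w ^+ e *: z != 0.
  by rewrite scaler_eq0 negb_or z0 expf_neq0.
have Ih0 : forall g, I g -> mmap mpC h0 g = 0.
  by apply: fermat_ideal_ker; rewrite /h0 /= ?unity_scale subrr mulr0.
have cof0 : mmap mpC h0 cof != 0.
  rewrite /cof !rmorphM /= !mmapX !mmap1U /h0 /=.
  have cofE a e : mmap mpC h0 'X_a = w ^+ e *: z ->
      mmap mpC h0 (cofactor 'X_a (w ^+ e *: z)) != 0.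
    move=> ha; have -> : mmap mpC h0 (cofactor 'X_a (w ^+ e *: z)) =
        cofactor (w ^+ e *: z) (w ^+ e *: z).
      rewrite rmorph_sum; apply: eq_bigr => i _; rewrite rmorphM !rmorphXn /= ha.
      by rewrite mmapZ mmapX mmap1U -mul_mpolyC.
    by rewrite cofactor_diag -mulr_natr -mpolyC_nat mulrC mul_mpolyC scaler_eq0
      negb_or pnatr_eq0 -lt0n n_gt0 expf_neq0.
  by rewrite !mulf_neq0 // cofE // mmapX mmap1U.
have Icof i : I (('X_i - h0 i) * cof).
  case: i => [[|[|[|]]]] // i3; rewrite (bool_irrelevance i3 isT) /h0 /=.
  - have -> : ('X_i0 - w ^+ u *: z) * cof =
        (- x * cofactor y (w ^+ v *: z)) * (y * (z ^+ n - x ^+ n)).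
      have := subrXX x (w ^+ u *: z) n; rewrite unity_scale -/(cofactor _ _) => def_x.
      by rewrite -[z ^+ n - _]opprB def_x /cof -/x; ring.
    exact: IM.
  - have -> : ('X_i1 - w ^+ v *: z) * cof =
        (y * cofactor x (w ^+ u *: z)) * (x * (y ^+ n - z ^+ n)).
      have := subrXX y (w ^+ v *: z) n; rewrite unity_scale -/(cofactor _ _) => def_y.
      by rewrite def_y /cof -/y; ring.
    exact: IM.
  - by rewrite subrr mul0r.
have V := symbolic_power_perturb h1 fermat_ideal_ideal Ih0 cof0 Icof If.
have perturbX (mm : 'X_{1..3}) : mmap1 (fun i => (h0 i)%:P + (h1 i)%:P * 'X) mm =
    ((w ^+ (u * mm i0 + v * mm i1))%:MP * z ^+ mdeg mm)%:P *
    map_poly mpC (monomial_on_line t mm).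
  have lineE (g : R3) (c : K) :
      g%:P + (c *: g)%:P * 'X = g%:P * map_poly mpC (1 + c *: 'X).
    rewrite rmorphD rmorph1 /= map_polyZ map_polyX -mul_mpolyC polyCM -mul_polyC /=.
    by ring.
  rewrite mprod3 /h0 /h1 /= !lineE polyC0 mul0r addr0 msum3 /monomial_on_line.
  rewrite [w ^+ (_ + _)]exprD [w ^+ (u * _)]exprM [w ^+ (v * _)]exprM.
  rewrite -!mul_mpolyC; move: (w ^+ u) (w ^+ v) => a b.
  by rewrite !rmorphM !exprMn -!rmorphXn /= !exprD !rmorphM /=; ring.
have := V _ lm; rewrite {1}[f]mpolyE /perturb raddf_sum coef_sum => /= coef_f.
have := congr1 (mcoeff (U_(i2) *+ d)) coef_f; rewrite raddf_sum mcoeff0 /= => coef0.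
rewrite -[RHS]coef0 big_mkcond; apply: eq_bigr => mm _.
rewrite mmapZ mmapX perturbX /= mulrA -polyCM coefCM coef_map /=.
rewrite [_ * mpC _`_l]mulrC !mcoeffCM mpolyXn mcoeffX.
have -> : ((U_(i2) *+ mdeg mm)%MM == (U_(i2) *+ d)%MM) = (mdeg mm == d).
  apply/eqP/eqP => [/(congr1 (fun k : 'X_{1..3} => k i2))|-> //].
  by rewrite !mulmnE mnmE eqxx !mul1n.
by case: eqP => _; rewrite /= ?mulr0 ?mulr1 //; ring.
Qed.

(* The characters of the [n]-th roots of unity separate the exponents modulo [n]. *)
Lemma symbolic_power_class t a b d l m f :
    symbolic_power I m f -> (l < m)%N -> (a < n)%N -> (b < n)%N ->
  \sum_(mm <- msupp f | [&& mm i0 %% n == a, mm i1 %% n == b & mdeg mm == d]%N)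
    f@_mm * (monomial_on_line t mm)`_l = 0.
Proof.
move=> If lm an bn.
(* Orthogonality of characters; [n - e] stands for -e modulo n. *)
have unity_sum c e : (e < n)%N ->
    \sum_(u < n) w ^+ (u * (c + (n - e))) = if (c %% n == e)%N then n%:R else 0.
  move=> en; have -> : (c %% n == e)%N = (n %| c + (n - e))%N.
    by rewrite -[X in _ == X](modn_small en) -(eqn_modDr (n - e)) subnKC ?modnn // ltnW.
  rewrite (prim_order_dvd w_prim); case: eqP => [we|/eqP we].
    rewrite (eq_bigr (fun=> 1)) ?sumr_const ?card_ord // => u _.
    by rewrite mulnC exprM we expr1n.
  under eq_bigr do rewrite mulnC exprM.
  set v := w ^+ _ in we *; have vn : v ^+ n = 1.
    by rewrite -exprM mulnC exprM (prim_expr_order w_prim) expr1n.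
  have /esym/eqP := subrX1 v n.
  by rewrite vn subrr mulf_eq0 subr_eq0 (negPf we) => /eqP.
pose g (mm : 'X_{1..3}) : K := f@_mm * (monomial_on_line t mm)`_l.
have separate : \sum_(u < n) \sum_(v < n) w ^+ (u * (n - a) + v * (n - b)) *
      \sum_(mm <- msupp f | mdeg mm == d)
        f@_mm * w ^+ (u * mm i0 + v * mm i1) * (monomial_on_line t mm)`_l =
    \sum_(mm <- msupp f | mdeg mm == d) g mm *
      ((\sum_(u < n) w ^+ (u * (mm i0 + (n - a)))) *
       (\sum_(v < n) w ^+ (v * (mm i1 + (n - b))))).
  under [RHS]eq_bigr do rewrite big_distrlr mulr_sumr.
  rewrite [RHS]exchange_big /=; apply: eq_bigr => u _.
  under [RHS]eq_bigr do rewrite mulr_sumr.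
  rewrite [RHS]exchange_big /=; apply: eq_bigr => v _.
  rewrite mulr_sumr; apply: eq_bigr => mm _.
  by rewrite /g !mulnDr !exprD; ring.
have nn : n%:R * n%:R != 0 :> K by rewrite mulf_neq0 // pnatr_eq0 -lt0n.
apply: (mulfI nn); rewrite mulr0.
transitivity (\sum_(mm <- msupp f | mdeg mm == d) g mm *
    ((\sum_(u < n) w ^+ (u * (mm i0 + (n - a)))) *
     (\sum_(v < n) w ^+ (v * (mm i1 + (n - b)))))); last first.
  rewrite -separate big1 // => u _; rewrite big1 // => v _.
  by rewrite (symbolic_power_fermat_point u v t d If lm) mulr0.
rewrite mulr_sumr big_mkcond [RHS]big_mkcond; apply: eq_bigr => mm _.
rewrite !unity_sum // /g; case: (mdeg mm == d); case: eqP => //= _; case: eqP => //= _.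
all: by rewrite ?mulr0 ?mul0r ?mulr0 // mulrC.
Qed.

Let exponent_class (mm : 'X_{1..3}) : nat * nat * nat * nat :=
  (mm i0 %% n, mm i1 %% n, mm i2 %% n, mm i0 %/ n + mm i1 %/ n + mm i2 %/ n)%N.

(** The third residue and the sum of the quotients are determined by the data that
    [symbolic_power_class] fixes. *)
Let exponent_classE mm i j k e : (i < n)%N -> (j < n)%N -> (k < n)%N ->
  (exponent_class mm == (i, j, k, e)) =
  [&& mm i0 %% n == i, mm i1 %% n == j & mdeg mm == i + j + k + n * e]%N.
Proof.
move=> ni nj nk; rewrite /exponent_class !xpair_eqE msum3.
move: (mm i0 %/ n)%N (mm i0 %% n)%N (divn_eq (mm i0) n) => p a ->.
move: (mm i1 %/ n)%N (mm i1 %% n)%N (divn_eq (mm i1) n) => q b ->.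
move: (mm i2 %/ n)%N (mm i2 %% n)%N (divn_eq (mm i2) n) (ltn_pmod (mm i2) n_gt0).
move=> s c -> cn; rewrite -!andbA.
case: eqP => [->|//]; case: eqP => [->|//] /=.
apply/andP/eqP => [[/eqP-> /eqP<-]|E]; first by ring.
have {}E : ((p + q + s) * n + c = e * n + k)%N by lia.
have := congr1 (modn^~ n) E; rewrite !modnMDl !modn_small // => ck.
by move: E; rewrite ck eqxx => /addIn/eqP; rewrite eqn_pmul2r.
Qed.

Let phi (t : K) : {rmorphism R3 -> {poly K}} :=
  mmap (@polyC K) (fun i : 'I_3 => [:: 1 + t *: 'X; 1 + 1 *: 'X; 1]`_i).

Let phiX t mm : phi t 'X_[mm] = monomial_on_line t mm.
Proof. by rewrite /phi /= mmapX mprod3 /= expr1n mulr1. Qed.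

Let phiZ t (c : K) g : phi t (c *: g) = c *: phi t g.
Proof. by rewrite /phi /= mmapZ mul_polyC. Qed.

Let phi_var t : (phi t x = 1 + t *: 'X) * (phi t y = 1 + 1 *: 'X) * (phi t z = 1).
Proof. by rewrite /phi /= !mmapX !mmap1U. Qed.

Let leading_diff (s t : K) :
  leading_at 1 ((1 + s *: 'X) ^+ n - (1 + t *: 'X) ^+ n : {poly K}) (n%:R * (s - t)).
Proof.
split=> [[|//] _|]; rewrite coefB !coef01_expX ?subrr //.
by rewrite mulrBr !mulr_natl.
Qed.

(** The class part is x^i y^j z^k h, with h a form of degree e in the n-th powers. The order of h at
    (1:1:1) is raised from 0 to m by [admissible_spanS]; the resulting line products are Fermat
    monomials once the prefactor is restored. *)
Let class_part_mem (Q : set R3) m f i j k e :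
    is_ideal Q ->
    (forall i' j' k' a b c, (a + b + c = m)%N ->
       vanishing_exponents n m i' j' k' a b c ->
       Q (fermat_monomial n x y z i' j' k' a b c)) ->
    symbolic_power I m f -> (i < n)%N -> (j < n)%N -> (k < n)%N ->
  Q (\sum_(mm <- msupp f | exponent_class mm == (i, j, k, e)) f@_mm *: 'X_[mm]).
Proof.
move=> idQ Qmon If ni nj nk; have [Q0 QD QM] := idQ.
(* [ceil c] is the least v with m <= c + n v: the order left to h when the prefactor contributes
   c. *)
pose ceil c := ((m - c + n.-1) %/ n)%N.
have ceilP c v : (m <= c + n * v)%N = (ceil c <= v)%N.
  rewrite -[RHS]ltnS ltn_divLR // mulSn; nia.
pose e1 := ceil (j + k)%N; pose e2 := ceil (i + k)%N; pose e3 := ceil (i + j)%N.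
pose h : R3 := \sum_(mm <- msupp f | exponent_class mm == (i, j, k, e))
   f@_mm *: line_product (x ^+ n) (y ^+ n) (z ^+ n)
              (mm i0 %/ n) (mm i1 %/ n) (mm i2 %/ n) 0 0 0.
have fE : \sum_(mm <- msupp f | exponent_class mm == (i, j, k, e)) f@_mm *: 'X_[mm] =
    x ^+ i * y ^+ j * z ^+ k * h.
  rewrite mulr_sumr; apply: eq_bigr => mm /eqP[<- <- <- _].
  rewrite -scalerAr; congr (_ *: _); rewrite /line_product !expr0 !mulr1.
  rewrite -[LHS]mmap1_id mprod3 -/x -/y -/z.
  rewrite [in LHS](divn_eq (mm i0) n) [in LHS](divn_eq (mm i1) n).
  rewrite [in LHS](divn_eq (mm i2) n) !exprD ![(_ * n)%N]mulnC !exprM.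
  by rewrite [X in X * _ = _]mulrACA [LHS]mulrACA [LHS]mulrC.
have h0 : admissible_span (x ^+ n) (y ^+ n) (z ^+ n) e e1 e2 e3 0 h.
  rewrite /h -big_filter big_seq; apply: kspan_sum => mm.
  rewrite mem_filter => /andP[/eqP[mi mj mk me] mmf].
  rewrite -[_ *: _]addr0; apply: kspan_cons; last exact: kspan0.
  exists (mm i0 %/ n)%N, (mm i1 %/ n)%N, (mm i2 %/ n)%N, 0%N, 0%N, 0%N.
  have [v1 v2 v3] := symbolic_power_exponents If mmf.
  split=> //; split; rewrite ?addn0 // -ceilP.
  - move: mj mk v1 (divn_eq (mm i1) n) (divn_eq (mm i2) n).
    move: (mm i1 %/ n)%N (mm i2 %/ n)%N => q s; rewrite mulnDr; lia.
  - move: mi mk v2 (divn_eq (mm i0) n) (divn_eq (mm i2) n).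
    move: (mm i0 %/ n)%N (mm i2 %/ n)%N => p s; rewrite mulnDr; lia.
  - move: mi mj v3 (divn_eq (mm i0) n) (divn_eq (mm i1) n).
    move: (mm i0 %/ n)%N (mm i1 %/ n)%N => p q; rewrite mulnDr; lia.
have phi_h t : vanishing m (phi t h).
  apply: (@vanishing_cancel _ _ (phi t (x ^+ i * y ^+ j * z ^+ k))).
    rewrite !rmorphM !rmorphXn /= !phi_var expr1n mulr1 coef0M !coef01_expX mulr1.
    exact: oner_neq0.
  rewrite -rmorphM -fE => l lm; rewrite raddf_sum coef_sum /=.
  rewrite -[RHS](symbolic_power_class t (i + j + k + n * e) If lm ni nj).
  by apply: eq_big => mm; [exact: exponent_classE | rewrite phiZ phiX coefZ].
have hm : admissible_span (x ^+ n) (y ^+ n) (z ^+ n) e e1 e2 e3 m h.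
  have leading1 t : leading_at 0 ((1 + t *: 'X) ^+ n : {poly K}) 1.
    by split=> //; rewrite coef01_expX.
  have phi_z t : phi t z = 1 + 0 *: 'X by rewrite phi_var scale0r addr0.
  suff: forall l, (l <= m)%N ->
    admissible_span (x ^+ n) (y ^+ n) (z ^+ n) e e1 e2 e3 l h.
    exact.
  elim=> [//|l IHl lm].
  apply: (@admissible_spanS _ _ _ _ _ _ _ _ _ phi n%:R) => //.
  all: try by move=> t; rewrite ?rmorphB !rmorphXn /= !phi_var.
  - by rewrite pnatr_eq0 -lt0n.
  - by move=> t; rewrite rmorphXn /= phi_z.
  - move=> t; rewrite rmorphB !rmorphXn /= phi_z !phi_var.
    by have := leading_diff 1 0; rewrite subr0 mulr1.
  - move=> t; rewrite rmorphB !rmorphXn /= phi_z !phi_var.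
    by have := leading_diff 0 t; rewrite sub0r mulrN.
  - exact/IHl/ltnW.
  - by move=> t l' l'l; apply: phi_h; lia.
rewrite fE; elim: hm => [|c u v [p [q [s [a [b [d [[abd _ v1 v2 v3] ->]]]]]]] _ IH].
  by rewrite mulr0.
rewrite mulrDr; apply: QD => //; rewrite -mul_mpolyC mulrCA; apply: QM.
have -> : x ^+ i * y ^+ j * z ^+ k * line_product (x ^+ n) (y ^+ n) (z ^+ n) p q s a b d
    = fermat_monomial n x y z (i + n * p) (j + n * q) (k + n * s) a b d.
  by rewrite /fermat_monomial /line_product !exprD !exprM; ring.
apply: Qmon => //; rewrite -ceilP in v1; rewrite -ceilP in v2; rewrite -ceilP in v3.
split; nia.
Qed.

(** The class parts of [f] need not be shown to lie in the symbolic power: their vanishing is read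
    off from [f] itself. *)
Lemma symbolic_power_sub (Q : set R3) m :
    is_ideal Q ->
    (forall i j k a b c, (a + b + c = m)%N -> vanishing_exponents n m i j k a b c ->
       Q (fermat_monomial n x y z i j k a b c)) ->
  symbolic_power I m `<=` Q.
Proof.
move=> idQ Qmon f If; have [Q0 QD _] := idQ.
have -> : f = \sum_(C <- undup [seq exponent_class mm | mm <- msupp f])
    \sum_(mm <- msupp f | exponent_class mm == C) f@_mm *: 'X_[mm].
  under eq_bigr do rewrite big_mkcond.
  rewrite exchange_big {1}[f]mpolyE /=; apply: eq_big_seq => mm mmf.
  rewrite (bigD1_seq (exponent_class mm)) ?undup_uniq ?mem_undup ?map_f //=.
  by rewrite eqxx big1 ?addr0 // => C /negPf; rewrite eq_sym => ->.
rewrite big_seq; apply: big_ind => // C; rewrite mem_undup => /mapP[mm _ ->].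
by apply: (class_part_mem _ idQ Qmon If); exact: ltn_pmod.
Qed.

End FermatPoints.

(** * Containments *)

(** In characteristic 0, X^n - 1 is separable, so it has n distinct roots, among which one is
    primitive. *)
Lemma prim_root_exists (F : numClosedFieldType) (n : nat) :
  (0 < n)%N -> exists w : F, n.-primitive_root w.
Proof.
move=> n_gt0; have [rs rsE] := closed_field_poly_normal ('X^n - 1 : {poly F}).
rewrite (monicP (monicXnsubC 1 n_gt0)) scale1r in rsE.
suff /hasP[w _ w_prim] : has n.-primitive_root rs by exists w.
apply: has_prim_root => //; first by apply/allP => u; rewrite -root_prod_XsubC -rsE.
  by rewrite -separable_prod_XsubC -rsE separable_Xn_sub_1 // pnatr_eq0 -lt0n.
by rewrite -ltnS -(size_prod_XsubC rs id) -rsE size_XnsubC.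
Qed.

(** Reduces a containment to two degree bounds. The alternative with m = r covers monomials that are
    already products of the generators and spare variables. *)
Lemma fermat_symbolic_power_sub (F : numClosedFieldType) (n m r s : nat) :
    (2 <= n)%N -> (r <= m)%N ->
    (forall i j k a b c, (a + b + c = m)%N -> vanishing_exponents n m i j k a b c ->
      [/\ a <= i, b <= j, c <= k & m = r]%N \/
      (r + n <= (i + j + k + n * (m - r)).+1)%N) ->
    (forall i j k a b c, (a + b + c = m)%N -> vanishing_exponents n m i j k a b c ->
      (r + s <= i + j + k + n * (m - r))%N) ->
  symbolic_power (fermat_ideal F n) m
    `<=` ideal_mul (ideal_exp (max_ideal F) s) (ideal_exp (fermat_ideal F n) r).
Proof.
move=> n2 rm rn rs; have n_gt0 : (0 < n)%N by exact: ltnW.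
have [w w_prim] := prim_root_exists F n_gt0.
have [Ix Iy Iz] := fermat_ideal_gens F n.
have [Mx My Mz] : [/\ max_ideal F 'X_i0, max_ideal F 'X_i1 & max_ideal F 'X_i2].
  by split; apply: sub_ideal_gen; [left; left | left; right | right].
apply: (symbolic_power_sub n_gt0 w_prim (ideal_mul_ideal _ _)) => i j k a b c abc van.
have := rs _ _ _ _ _ _ abc van; case: (rn _ _ _ _ _ _ abc van) => [[ai bj ck mr]|].
  rewrite mr subnn muln0 addn0; apply: fermat_monomial_mem_base => //.
  by rewrite abc mr.
move=> rn' rs'; apply: (fermat_monomial_mem Mx My Mz Ix Iy Iz n2 rm abc) => //.
by case: van => v1 v2 v3; split; lia.
Qed.

Theorem corollary1p3 (R : realType) (n : nat) (hn : (2 <= n)%N) :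
  let I : set {mpoly (complex R)[3]} := fermat_ideal (complex R) n in
  let m : set {mpoly (complex R)[3]} := max_ideal (complex R) in
  [/\ forall r : nat, (1 <= r)%N ->
        symbolic_power I (2 * r)
          `<=` ideal_mul (ideal_exp m r) (ideal_exp I r),
      ((3 <= n)%N -> forall r : nat, (3 <= r)%N ->
        symbolic_power I (2 * r - 1)
          `<=` ideal_mul (ideal_exp m (r - 1)) (ideal_exp I r))
      /\ (n = 2%N -> forall r : nat, (1 <= r)%N ->
        symbolic_power I (2 * r - 1)
          `<=` ideal_mul (ideal_exp m (r - 1)) (ideal_exp I r))
    & forall r : nat, (5 <= r)%N ->
        symbolic_power I (2 * r - 2)
          `<=` ideal_mul (ideal_exp m r) (ideal_exp I r)].
Proof.
split; last 1 first.
- move=> r r5.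
  have eM : (2 * r - 2 - r = r - 2)%N by lia.
  have bound i j k a b c : (a + b + c = 2 * r - 2)%N ->
      vanishing_exponents n (2 * r - 2) i j k a b c ->
      (r + n <= (i + j + k + n * (r - 2)).+1)%N /\
      (r + r <= i + j + k + n * (r - 2))%N.
    move=> abc [v1 v2 v3].
    have [n2|[n3|n4]] : (n = 2 \/ n = 3 \/ 4 <= n)%N by lia.
    (* Adding the three order conditions gives i + j + k >= r - 1. *)
    + by subst n; lia.
    (* For r = 5 integrality matters: i = j = k = 0 would need 3a, 3b, 3c >= 8, hence a + b + c >= 9
       > 8. *)
    + by subst n; lia.
    + by nia.
  apply: fermat_symbolic_power_sub => // [|i j k a b c abc van|i j k a b c abc van].
    by lia.
    by right; rewrite eM; have [] := bound _ _ _ _ _ _ abc van.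
  by rewrite eM; have [] := bound _ _ _ _ _ _ abc van.
- move=> r r1.
  have eM : (2 * r - r = r)%N by lia.
  apply: fermat_symbolic_power_sub => // [|i j k a b c _ _|i j k a b c _ _].
    by lia.
    by right; rewrite eM; nia.
  by rewrite eM; nia.
- split=> [n3 r r3|n2 r r1].
    have eM : (2 * r - 1 - r = r - 1)%N by lia.
    apply: fermat_symbolic_power_sub => // [|i j k a b c _ _|i j k a b c _ _].
      by lia.
      by right; rewrite eM; nia.
    by rewrite eM; nia.
  rewrite n2; have eM : (2 * r - 1 - r = r - 1)%N by lia.
  apply: fermat_symbolic_power_sub => //; first lia.
    move=> i j k a b c abc [v1 v2 v3]; rewrite eM.
    (* The bound fails only for r = 1 and i + j + k = 1, where the monomial is xU, yV or zW. *)
    have [N2|N1] := leqP (r + 2) (i + j + k + 2 * (r - 1)).+1; first by right.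
    by left; split; lia.
  by move=> i j k a b c abc [v1 v2 v3]; rewrite eM; lia.
Qed.
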